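(* Let $\omega(x,y,z) = xyz - zyx$ (the anti-Jordan family, $q=\tfrac12$) and $\omega'(x,y,z) = [x,y\circ z]$ (the Lie family, $q=\tfrac12$), where $[u,v]=uv-vu$ and $u\circ v = \tfrac12(uv+vu)$. Then the universal associative envelope $U(A^{\omega})$ is isomorphic to the down-up algebra $A(0,1,0)$, so that $U(A^{\omega}) \cong U(A^{\omega'})$ as unital associative algebras.
   Context: $\mathbb{F}$ is a field of characteristic $0$. $A$ is the 2-dimensional space of $2\times 2$ matrices over $\mathbb{F}$ with zero diagonal, with basis $e_1 = \begin{bmatrix} 0&1\\0&0\end{bmatrix}$, $e_2 = \begin{bmatrix} 0&0\\1&0\end{bmatrix}$; it is closed under triple products $xyz$ of matrices. For a trilinear operation $\omega(x,y,z)$ (a fixed rational linear combination of the six products of $x,y,z$ in all orders), $A^\omega$ denotes the space $A$ with the trilinear operation $\omega$ computed using matrix multiplication. Let $\mathbb{F}\langle a,b\rangle$ be the free unital associative algebra and $\phi\colon A \to \mathbb{F}\langle a,b\rangle$ the linear map with $\phi(e_1)=a$, $\phi(e_2)=b$. The universal associative envelope is $U(A^\omega) = \mathbb{F}\langle a,b\rangle / I$, where $I$ is the two-sided ideal generated by the elements $\omega(\phi(x),\phi(y),\phi(z)) - \phi(\omega(x,y,z))$ for $x,y,z\in\{e_1,e_2\}$. For $\alpha,\beta,\gamma\in\mathbb{F}$, the down-up algebra $A(\alpha,\beta,\gamma)$ is the unital associative $\mathbb{F}$-algebra with generators $a,b$ and relations $b^2a = \alpha bab + \beta ab^2 + \gamma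 b$ and $ba^2 = \alpha aba + \beta a^2 b + \gamma a$. *)

(* Defs.v *)
From HB Require Import structures.
From mathcomp Require Import all_boot all_order all_algebra.
From mathcomp Require Import finmap.
From mathcomp.multinomials Require Import monalg.
From mathcomp.classical Require Import boolp.

Set Implicit Arguments.
Unset Strict Implicit.
Unset Printing Implicit Defensive.

Import GRing.Theory.
Local Open Scope ring_scope.
Local Open Scope quotient_scope.

(* ring_quotient only provides idealr, i.e. proper additive subgroups closed
   under left multiplication, and only equips quotients of commutative rings
   with a product. *)
HB.mixin Record isMulrStable (R : nzRingType) (S : R -> bool) := {
  mulr_stable_subproof : forall u v, u \in S -> u * v \in S
}.

#[short(type="tsideal")]
HB.structure Definition TwoSidedIdeal (R : nzRingType) :=
  {S of Idealr R S & isMulrStable R S}.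

Lemma tsidealMl (R : nzRingType) (I : tsideal R) (u v : R) :
  u \in (I : pred R) -> u * v \in (I : pred R).
Proof. exact: mulr_stable_subproof. Qed.

Lemma tsidealMr (R : nzRingType) (I : tsideal R) (u v : R) :
  v \in (I : pred R) -> u * v \in (I : pred R).
Proof. exact: idealMr. Qed.

Section AlgQuotient.
Variables (F : fieldType) (B : algType F) (I : tsideal B).

Definition alg_quot : Type := {ideal_quot I}.

HB.instance Definition _ := GRing.Zmodule.on alg_quot.

Definition alg_pi (x : B) : alg_quot := \pi_({ideal_quot I}) x.
Definition alg_repr (x : alg_quot) : B := repr (x : {ideal_quot I}).

Lemma alg_reprK : cancel alg_repr alg_pi.
Proof. by move=> x; exact: reprK. Qed.

Lemma alg_pi_eq (x y : B) :
  (alg_pi x == alg_pi y) = (x - y \in (I : pred B)).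
Proof. by rewrite (Quotient.idealrBE I). Qed.

Lemma alg_pi_zmod_morphism : zmod_morphism alg_pi.
Proof. by move=> x y; rewrite /alg_pi pi_addr pi_oppr. Qed.

HB.instance Definition _ :=
  GRing.isZmodMorphism.Build B alg_quot alg_pi alg_pi_zmod_morphism.

Let repr_pi (x : B) : x - alg_repr (alg_pi x) \in (I : pred B).
Proof. by rewrite -alg_pi_eq alg_reprK. Qed.

Let qone : alg_quot := alg_pi 1.
Let qmul (x y : alg_quot) : alg_quot := alg_pi (alg_repr x * alg_repr y).
Let qscale (c : F) (x : alg_quot) : alg_quot := alg_pi (c *: alg_repr x).

Let qmulE x y : qmul (alg_pi x) (alg_pi y) = alg_pi (x * y).
Proof.
apply/esym/eqP; rewrite alg_pi_eq.
set x' := alg_repr _; set y' := alg_repr _.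
have -> : x * y - x' * y' = (x - x') * y + x' * (y - y').
  by rewrite mulrBl mulrBr addrA subrK.
by apply: rpredD; [apply: tsidealMl | apply: tsidealMr]; exact: repr_pi.
Qed.

Let qscaleE c x : qscale c (alg_pi x) = alg_pi (c *: x).
Proof.
apply/esym/eqP; rewrite alg_pi_eq.
by rewrite -scalerBr -mulr_algl; apply: tsidealMr; exact: repr_pi.
Qed.

Let qaddE (x y : B) : alg_pi x + alg_pi y = alg_pi (x + y).
Proof. by rewrite raddfD. Qed.

Let qmulA : associative qmul.
Proof.
move=> x y z; rewrite -[x]alg_reprK -[y]alg_reprK -[z]alg_reprK.
by rewrite !qmulE mulrA.
Qed.

Let qmul1 : left_id qone qmul.
Proof. by move=> x; rewrite -[x]alg_reprK qmulE mul1r. Qed.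

Let qmulq1 : right_id qone qmul.
Proof. by move=> x; rewrite -[x]alg_reprK qmulE mulr1. Qed.

Let qmulDl : left_distributive qmul +%R.
Proof.
move=> x y z; rewrite -[x]alg_reprK -[y]alg_reprK -[z]alg_reprK.
by rewrite !(qaddE, qmulE) mulrDl.
Qed.

Let qmulDr : right_distributive qmul +%R.
Proof.
move=> x y z; rewrite -[x]alg_reprK -[y]alg_reprK -[z]alg_reprK.
by rewrite !(qaddE, qmulE) mulrDr.
Qed.

Let qone_neq0 : qone != 0.
Proof. by rewrite -(raddf0 alg_pi) alg_pi_eq subr0 idealr1. Qed.

HB.instance Definition _ := GRing.Zmodule_isNzRing.Build alg_quot
  qmulA qmul1 qmulq1 qmulDl qmulDr qone_neq0.

Let qscaleA a b x : qscale a (qscale b x) = qscale (a * b) x.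
Proof. by rewrite -[x]alg_reprK !qscaleE scalerA. Qed.

Let qscale1 : left_id 1 qscale.
Proof. by move=> x; rewrite -[x]alg_reprK qscaleE scale1r. Qed.

Let qscaleDr : right_distributive qscale +%R.
Proof.
move=> c x y; rewrite -[x]alg_reprK -[y]alg_reprK.
by rewrite !(qaddE, qscaleE) scalerDr.
Qed.

Let qscaleDl x : {morph qscale^~ x : a b / a + b}.
Proof.
by move=> a b; rewrite -[x]alg_reprK !qscaleE qaddE scalerDl.
Qed.

HB.instance Definition _ := GRing.Zmodule_isLmodule.Build F alg_quot
  qscaleA qscale1 qscaleDr qscaleDl.

Lemma alg_pi_monoid_morphism : monoid_morphism alg_pi.
Proof. by split=> [//|x y]; rewrite -[LHS]qmulE. Qed.

HB.instance Definition _ :=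
  GRing.isMonoidMorphism.Build B alg_quot alg_pi alg_pi_monoid_morphism.

Lemma alg_pi_scalable : scalable alg_pi.
Proof. by move=> c x; rewrite -[LHS]qscaleE. Qed.

Let qpiM (x y : B) : alg_pi (x * y) = alg_pi x * alg_pi y.
Proof. exact: rmorphM. Qed.

Let qscaleAl (c : F) (x y : alg_quot) : c *: (x * y) = (c *: x) * y.
Proof.
rewrite -[x]alg_reprK -[y]alg_reprK.
by rewrite -qpiM -alg_pi_scalable scalerAl qpiM alg_pi_scalable.
Qed.

HB.instance Definition _ := GRing.Lmodule_isLalgebra.Build F alg_quot qscaleAl.

Let qscaleAr (c : F) (x y : alg_quot) : c *: (x * y) = x * (c *: y).
Proof.
rewrite -[x]alg_reprK -[y]alg_reprK.
by rewrite -qpiM -alg_pi_scalable scalerAr qpiM alg_pi_scalable.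
Qed.

HB.instance Definition _ :=
  GRing.Lalgebra_isAlgebra.Build F alg_quot qscaleAr.

HB.instance Definition _ :=
  GRing.isScalable.Build F B alg_quot *:%R alg_pi alg_pi_scalable.

End AlgQuotient.

Section GeneratedIdeal.
Variables (R : nzRingType).

Inductive ideal_gen (S : R -> Prop) : R -> Prop :=
| ideal_gen_rel x of S x : ideal_gen S x
| ideal_gen0 : ideal_gen S 0
| ideal_genD x y of ideal_gen S x & ideal_gen S y : ideal_gen S (x + y)
| ideal_genMl x y of ideal_gen S x : ideal_gen S (y * x)
| ideal_genMr x y of ideal_gen S x : ideal_gen S (x * y).

Definition ideal_genb (S : R -> Prop) (x : R) : bool := `[< ideal_gen S x >].

Lemma ideal_gen_ker (T : nzRingType) (g : {rmorphism R -> T}) (S : R -> Prop) :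
  (forall x, S x -> g x = 0) -> forall x, ideal_gen S x -> g x = 0.
Proof.
move=> gS x; elim=> {x} [x /gS //||x y _ gx _ gy|x y _ gx|x y _ gx].
- by rewrite rmorph0.
- by rewrite rmorphD gx gy addr0.
- by rewrite rmorphM gx mulr0.
- by rewrite rmorphM gx mul0r.
Qed.

Lemma ideal_genb_zmod S : zmod_closed (ideal_genb S).
Proof.
split=> [|x y /asboolP Sx /asboolP Sy]; apply/asboolP; first exact: ideal_gen0.
by apply: ideal_genD => //; rewrite -mulN1r; apply: ideal_genMl.
Qed.

Lemma ideal_genb_proper (T : nzRingType) (g : {rmorphism R -> T}) S :
  (forall x, S x -> g x = 0) ->
  1 \notin ideal_genb S /\
  forall u, {in ideal_genb S, forall v, u * v \in ideal_genb S}.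
Proof.
move=> gS; split=> [|u v /asboolP Sv]; last exact/asboolP/ideal_genMl.
apply/negP => /asboolP /(ideal_gen_ker gS)/eqP.
by rewrite rmorph1 oner_eq0.
Qed.

Lemma ideal_genb_mulr S (u v : R) :
  u \in ideal_genb S -> u * v \in ideal_genb S.
Proof. by move=> /asboolP Su; apply/asboolP/ideal_genMr. Qed.

End GeneratedIdeal.

(* The monoid algebra of the free monoid on 'I_2, i.e. F<a,b>. Over a
   noncommutative monoid, monalg stops at lalgType; moreover unification
   diverges on its product, scaling and monomials, hence the locked copies. *)
Definition free_alg (F : fieldType) : Type := {malg F[{fmonom 'I_2}]}.

HB.lock Definition free_mul (F : fieldType) (x y : free_alg F) : free_alg F :=
  (x : {malg F[{fmonom 'I_2}]}) * (y : {malg F[{fmonom 'I_2}]}).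
HB.lock Definition free_scale (F : fieldType) (c : F) (x : free_alg F) :
  free_alg F := c *: (x : {malg F[{fmonom 'I_2}]}).

HB.lock Definition fa (F : fieldType) : free_alg F :=
  << fmu (ord0 : 'I_2) >>%R.
HB.lock Definition fb (F : fieldType) : free_alg F :=
  << fmu (ord_max : 'I_2) >>%R.

Section FreeAlg.
Variable F : fieldType.
Implicit Types x y z : free_alg F.

HB.instance Definition _ := GRing.Zmodule.on (free_alg F).

Let free_mulA : associative (@free_mul F).
Proof. by rewrite unlock => x y z; exact: mulrA. Qed.

Let free_mul1 : left_id (1 : {malg F[{fmonom 'I_2}]}) (@free_mul F).
Proof. by rewrite unlock => x; exact: mul1r. Qed.

Let free_mulq1 : right_id (1 : {malg F[{fmonom 'I_2}]}) (@free_mul F).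
Proof. by rewrite unlock => x; exact: mulr1. Qed.

Let free_mulDl : left_distributive (@free_mul F) +%R.
Proof. by rewrite unlock => x y z; exact: mulrDl. Qed.

Let free_mulDr : right_distributive (@free_mul F) +%R.
Proof. by rewrite unlock => x y z; exact: mulrDr. Qed.

Let free_oner_neq0 : (1 : {malg F[{fmonom 'I_2}]}) != 0 :> free_alg F.
Proof. exact: oner_neq0. Qed.

HB.instance Definition _ := GRing.Zmodule_isNzRing.Build (free_alg F)
  free_mulA free_mul1 free_mulq1 free_mulDl free_mulDr free_oner_neq0.

Let free_scaleA a b x :
  free_scale a (free_scale b x) = free_scale (a * b) x.
Proof. by rewrite unlock; exact: scalerA. Qed.

Let free_scale1 : left_id 1 (@free_scale F).
Proof. by rewrite unlock => x; exact: scale1r. Qed.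

Let free_scaleDr : right_distributive (@free_scale F) +%R.
Proof. by rewrite unlock => c x y; exact: scalerDr. Qed.

Let free_scaleDl x : {morph (@free_scale F)^~ x : a b / a + b}.
Proof. by rewrite unlock => a b; exact: scalerDl. Qed.

HB.instance Definition _ := GRing.Zmodule_isLmodule.Build F (free_alg F)
  free_scaleA free_scale1 free_scaleDr free_scaleDl.

Lemma free_mulE x y :
  x * y = (x : {malg F[{fmonom 'I_2}]}) * (y : {malg F[{fmonom 'I_2}]}).
Proof. by rewrite /GRing.mul /= unlock. Qed.

Lemma free_scaleE (c : F) x :
  c *: x = c *: (x : {malg F[{fmonom 'I_2}]}).
Proof. by rewrite /GRing.scale /= unlock. Qed.

Let free_scaleAl (c : F) x y : c *: (x * y) = (c *: x) * y.
Proof. by rewrite !free_mulE !free_scaleE; exact: scalerAl. Qed.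

HB.instance Definition _ :=
  GRing.Lmodule_isLalgebra.Build F (free_alg F) free_scaleAl.

Let free_scaleAr (c : F) x y : c *: (x * y) = x * (c *: y).
Proof.
rewrite !free_mulE !free_scaleE.
apply/(@malgP _ _ (_ : {malg F[_]}) (_ : {malg F[_]})) => k.
rewrite [LHS]mcoeffZ [in LHS]mcoeffMl.
rewrite [RHS](mcoeffMlw _ (fsubset_refl _) (msuppZ_le _ _)) mulr_sumr.
apply: eq_bigr => k1 _; rewrite mulr_sumr; apply: eq_bigr => k2 _.
by rewrite mcoeffZ [in RHS]mulrCA mulrnAr.
Qed.

HB.instance Definition _ :=
  GRing.Lalgebra_isAlgebra.Build F (free_alg F) free_scaleAr.

(* The constant coefficient; it vanishes on all the relations below, which is
   why the ideals they generate are proper. *)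
Definition free_aug (x : free_alg F) : F := @mcoeff {fmonom 'I_2} F mone x.

Let free_aug_zmod_morphism : zmod_morphism free_aug.
Proof. by move=> x y; exact: mcoeffB. Qed.

HB.instance Definition _ :=
  GRing.isZmodMorphism.Build (free_alg F) F free_aug free_aug_zmod_morphism.

Let free_aug_monoid_morphism : monoid_morphism free_aug.
Proof.
by split=> [|x y]; [exact: malgCK | rewrite free_mulE; exact: rmorphM].
Qed.

HB.instance Definition _ :=
  GRing.isMonoidMorphism.Build (free_alg F) F free_aug
    free_aug_monoid_morphism.

Let free_aug_scalable : scalable_for *%R free_aug.
Proof. by move=> c x; rewrite free_scaleE; exact: mcoeffZ. Qed.

HB.instance Definition _ :=
  GRing.isScalable.Build F (free_alg F) F *%R free_aug free_aug_scalable.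

Lemma free_augB x y : free_aug (x - y) = free_aug x - free_aug y.
Proof. exact: rmorphB. Qed.

Lemma free_augD x y : free_aug (x + y) = free_aug x + free_aug y.
Proof. exact: rmorphD. Qed.

Lemma free_augM x y : free_aug (x * y) = free_aug x * free_aug y.
Proof. exact: rmorphM. Qed.

Lemma free_augZ c x : free_aug (c *: x) = c * free_aug x.
Proof. exact: free_aug_scalable. Qed.

Lemma free_aug_a : free_aug (fa F) = 0.
Proof. by rewrite /free_aug unlock mcoeffU1 -fdeg_eq0 fdegU. Qed.

Lemma free_aug_b : free_aug (fb F) = 0.
Proof. by rewrite /free_aug unlock mcoeffU1 -fdeg_eq0 fdegU. Qed.

End FreeAlg.

Section TwoGenerators.
Variable F : fieldType.

Inductive down_up_rel (alpha beta gamma : F) : free_alg F -> Prop :=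
| down_up_rel_ba : down_up_rel alpha beta gamma
    (fb F ^+ 2 * fa F - (alpha *: (fb F * fa F * fb F)
                         + beta *: (fa F * fb F ^+ 2) + gamma *: fb F))
| down_up_rel_ab : down_up_rel alpha beta gamma
    (fb F * fa F ^+ 2 - (alpha *: (fa F * fb F * fa F)
                         + beta *: (fa F ^+ 2 * fb F) + gamma *: fa F)).

Definition down_up_ideal (alpha beta gamma : F) : free_alg F -> bool :=
  ideal_genb (down_up_rel alpha beta gamma).

Lemma down_up_rel_aug alpha beta gamma r :
  down_up_rel alpha beta gamma r -> free_aug r = 0.
Proof.
by case=> {r}; rewrite free_augB !free_augD !free_augZ ?expr2 !free_augM
  ?free_aug_a ?free_aug_b !(mul0r, mulr0, addr0, subr0).
Qed.

HB.instance Definition _ alpha beta gamma :=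
  GRing.isZmodClosed.Build (free_alg F) (down_up_ideal alpha beta gamma)
    (ideal_genb_zmod _).
HB.instance Definition _ alpha beta gamma :=
  isProperIdeal.Build (free_alg F) (down_up_ideal alpha beta gamma)
    (ideal_genb_proper (@down_up_rel_aug alpha beta gamma)).
HB.instance Definition _ alpha beta gamma :=
  isMulrStable.Build (free_alg F) (down_up_ideal alpha beta gamma)
    (@ideal_genb_mulr _ _).

Definition down_up (alpha beta gamma : F) : algType F :=
  alg_quot (down_up_ideal alpha beta gamma).

(* A trilinear operation is a fixed rational combination of the six products
   of its arguments, hence makes sense in every associative algebra. Both
   matrices and F<a,b> are used as B below. *)
Record tri_op := TriOp {
  tri_fun :> forall B : algType F, B -> B -> B -> B;
  tri_funP : exists c : rat * rat * rat * rat * rat * rat,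
    let: (c1, c2, c3, c4, c5, c6) := c in
    forall (B : algType F) (x y z : B),
      tri_fun x y z = ratr c1 *: (x * y * z) + ratr c2 *: (x * z * y)
                    + ratr c3 *: (y * x * z) + ratr c4 *: (y * z * x)
                    + ratr c5 *: (z * x * y) + ratr c6 *: (z * y * x)
}.

Definition zero_diag (M : 'M[F]_2) : bool := [forall i, M i i == 0].

Lemma zero_diagP (M : 'M[F]_2) : reflect (forall i, M i i = 0) (zero_diag M).
Proof. by apply: (iffP forallP) => M0 i; apply/eqP. Qed.

Lemma zero_diag_submod : submod_closed zero_diag.
Proof.
split=> [|c M N /zero_diagP M0 /zero_diagP N0]; apply/zero_diagP => i.
  by rewrite mxE.
by rewrite !mxE M0 N0 mulr0 addr0.
Qed.

HB.instance Definition _ :=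
  GRing.isSubmodClosed.Build F 'M[F]_2 zero_diag zero_diag_submod.

Record zdmat := ZDMat {zdmat_val :> 'M[F]_2; _ : zero_diag zdmat_val}.

HB.instance Definition _ := [isSub for zdmat_val].
HB.instance Definition _ := [Choice of zdmat by <:].
HB.instance Definition _ := [SubChoice_isSubLmodule of zdmat by <:].

Lemma delta_zero_diag (i j : 'I_2) :
  i != j -> zero_diag (delta_mx i j : 'M[F]_2).
Proof.
move=> ij; apply/zero_diagP => k; rewrite mxE.
by case: eqP => [->|] //=; rewrite (negPf ij).
Qed.

Definition e1 : zdmat := ZDMat (@delta_zero_diag ord0 ord_max isT).
Definition e2 : zdmat := ZDMat (@delta_zero_diag ord_max ord0 isT).

Lemma zero_diag_mul3 (x y z : 'M[F]_2) :
  zero_diag x -> zero_diag y -> zero_diag z -> zero_diag (x * y * z).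
Proof.
move=> /zero_diagP x0 /zero_diagP y0 /zero_diagP z0; apply/zero_diagP => i.
rewrite mxE big1 // => j _; have [->|ji] := eqVneq j i.
  by rewrite z0 mulr0.
rewrite mxE big1 ?mul0r // => k _; have [->|ki] := eqVneq k i.
  by rewrite x0 mul0r.
have -> : k = j; last by rewrite y0 mulr0.
apply/val_inj; move: i j k ji ki.
by move=> [[|[|//]] ?] [[|[|//]] ?] [[|[|//]] ?].
Qed.

Lemma tri_op_zero_diag (w : tri_op) (x y z : zdmat) :
  zero_diag (w 'M[F]_2 x y z).
Proof.
have [[[[[[c1 c2] c3] c4] c5] c6] ->] := tri_funP w.
rewrite -[zero_diag _]/(_ \in zero_diag).
by rewrite !rpredD ?rpredZ //; apply: zero_diag_mul3; exact: valP.
Qed.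

Definition zd_op (w : tri_op) (x y z : zdmat) : zdmat :=
  ZDMat (tri_op_zero_diag w x y z).

Definition phi (x : zdmat) : free_alg F :=
  (x : 'M[F]_2) ord0 ord_max *: fa F + (x : 'M[F]_2) ord_max ord0 *: fb F.

Lemma phi_is_linear : linear phi.
Proof.
move=> c x y; rewrite /phi /= !mxE !scalerDl scalerDr -!scalerA.
by rewrite addrACA.
Qed.

HB.instance Definition _ :=
  GRing.isLinear.Build F zdmat (free_alg F) *:%R phi phi_is_linear.

Lemma phi_e1 : phi e1 = fa F.
Proof. by rewrite /phi /= !mxE /= scale1r scale0r addr0. Qed.

Lemma phi_e2 : phi e2 = fb F.
Proof. by rewrite /phi /= !mxE /= scale1r scale0r add0r. Qed.

Inductive env_rel (w : tri_op) : free_alg F -> Prop :=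
| EnvRel (x y z : zdmat) of
    x \in [:: e1; e2] & y \in [:: e1; e2] & z \in [:: e1; e2] :
    env_rel w (w (free_alg F) (phi x) (phi y) (phi z) - phi (zd_op w x y z)).

Definition env_ideal (w : tri_op) : free_alg F -> bool :=
  ideal_genb (env_rel w).

Lemma free_aug_phi x : free_aug (phi x) = 0.
Proof.
by rewrite free_augD !free_augZ free_aug_a free_aug_b !mulr0 addr0.
Qed.

Lemma env_rel_aug (w : tri_op) r : env_rel w r -> free_aug r = 0.
Proof.
case=> x y z _ _ _; rewrite free_augB free_aug_phi subr0.
have [[[[[[c1 c2] c3] c4] c5] c6] ->] := tri_funP w.
by rewrite !free_augD !free_augZ !free_augM !free_aug_phi !(mulr0, addr0).
Qed.

HB.instance Definition _ w :=
  GRing.isZmodClosed.Build (free_alg F) (env_ideal w) (ideal_genb_zmod _).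
HB.instance Definition _ w :=
  isProperIdeal.Build (free_alg F) (env_ideal w)
    (ideal_genb_proper (@env_rel_aug w)).
HB.instance Definition _ w :=
  isMulrStable.Build (free_alg F) (env_ideal w) (@ideal_genb_mulr _ _).

Definition univ_env (w : tri_op) : algType F := alg_quot (env_ideal w).

Definition lie_bracket (B : algType F) (u v : B) : B := u * v - v * u.
Definition jordan_prod (B : algType F) (u v : B) : B := 2^-1 *: (u * v + v * u).

Lemma anti_jordan_comb : exists c : rat * rat * rat * rat * rat * rat,
  let: (c1, c2, c3, c4, c5, c6) := c in
  forall (B : algType F) (x y z : B),
    x * y * z - z * y * x
    = ratr c1 *: (x * y * z) + ratr c2 *: (x * z * y)
    + ratr c3 *: (y * x * z) + ratr c4 *: (y * z * x)
    + ratr c5 *: (z * x * y) + ratr c6 *: (z * y * x).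
Proof.
exists (1, 0, 0, 0, 0, -1) => B x y z.
rewrite [ratr 1]divr1 [ratr 0]divr1 [ratr (- 1)]divr1 /=.
by rewrite !scale0r !addr0 scale1r scaleN1r.
Qed.

Definition anti_jordan : tri_op :=
  @TriOp (fun B x y z => x * y * z - z * y * x) anti_jordan_comb.

Lemma lie_comb : exists c : rat * rat * rat * rat * rat * rat,
  let: (c1, c2, c3, c4, c5, c6) := c in
  forall (B : algType F) (x y z : B),
    lie_bracket x (jordan_prod y z)
    = ratr c1 *: (x * y * z) + ratr c2 *: (x * z * y)
    + ratr c3 *: (y * x * z) + ratr c4 *: (y * z * x)
    + ratr c5 *: (z * x * y) + ratr c6 *: (z * y * x).
Proof.
exists (2^-1, 2^-1, 0, - 2^-1, 0, - 2^-1) => B x y z.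
have r2 : ratr 2^-1 = 2^-1 :> F by rewrite -[RHS]mul1r.
have rN2 : ratr (- 2^-1) = - 2^-1 :> F by rewrite -[RHS]mulN1r.
rewrite r2 rN2 [ratr 0]divr1 /= /lie_bracket /jordan_prod.
rewrite -scalerAr -scalerAl mulrDr mulrDl !mulrA.
by rewrite !scale0r !addr0 !scalerDr opprD !scaleNr !addrA.
Qed.

Definition lie_family : tri_op :=
  @TriOp (fun B x y z => lie_bracket x (jordan_prod y z)) lie_comb.

Definition alg_iso (B C : algType F) : Prop :=
  exists f : {lrmorphism B -> C}, bijective f.

End TwoGenerators.

(* Main.v *)
(* Products of three zero-diagonal 2x2 matrices satisfy xyz = zyx, so both
   operations vanish identically on A, and the relations of either envelope
   say only that the operation itself vanishes on a and b. As
   [x, y o z] = (omega(x,y,z) + omega(x,z,y)) / 2, in both cases this amounts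
   to b^2 a = a b^2 and b a^2 = a^2 b, the relations of A(0,1,0); hence the
   three defining ideals of F<a,b> coincide. *)

Require Import Defs.
From HB Require Import structures.
From mathcomp Require Import all_boot all_order all_algebra.
From mathcomp.classical Require Import boolp.

Set Implicit Arguments.
Unset Strict Implicit.
Unset Printing Implicit Defensive.

Import GRing.Theory.
Local Open Scope ring_scope.

Section AlgQuotientTheory.
Variables (F : fieldType) (B : algType F).

Lemma alg_pi_eq0 (I : tsideal B) (x : B) :
  (alg_pi I x == 0) = (x \in (I : pred B)).
Proof. by rewrite -(raddf0 (alg_pi I)) alg_pi_eq subr0. Qed.

(** [I] is the kernel of [alg_pi I], so inclusions of generated ideals become equations in the
    quotient by [I]. *)
Lemma ideal_gen_subP (I : tsideal B) (S : B -> Prop) :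
  (forall x, S x -> alg_pi I x = 0) <->
  {subset ideal_genb S <= (I : pred B)}.
Proof.
split=> [S0 x /asboolP Sx | sub x Sx].
  by rewrite -alg_pi_eq0; apply/eqP; exact: ideal_gen_ker S0 _ Sx.
by apply/eqP; rewrite alg_pi_eq0; apply/sub/asboolP/ideal_gen_rel.
Qed.

Variables (I J : tsideal B).

(** Built on chosen representatives, hence available for any two ideals; the choice stops mattering
    once [I] lies in [J]. *)
Definition alg_quot_map (x : alg_quot I) : alg_quot J := alg_pi J (alg_repr x).

Hypothesis IsubJ : {subset (I : pred B) <= (J : pred B)}.

Lemma alg_quot_mapE (x : B) : alg_quot_map (alg_pi I x) = alg_pi J x.
Proof.
by apply/eqP; rewrite alg_pi_eq; apply: IsubJ; rewrite -alg_pi_eq alg_reprK.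
Qed.

Lemma alg_quot_map_lrmorphism :
  exists f : {lrmorphism alg_quot I -> alg_quot J}, f =1 alg_quot_map.
Proof.
have fB : zmod_morphism alg_quot_map.
  move=> x y; rewrite -[x]alg_reprK -[y]alg_reprK -raddfB !alg_quot_mapE.
  exact: raddfB.
have fM : monoid_morphism alg_quot_map.
  split=> [|x y]; first by rewrite -(rmorph1 (alg_pi I)) alg_quot_mapE rmorph1.
  rewrite -[x]alg_reprK -[y]alg_reprK -rmorphM !alg_quot_mapE.
  exact: rmorphM.
have fZ : scalable alg_quot_map.
  move=> c x; rewrite -[x]alg_reprK -alg_pi_scalable !alg_quot_mapE.
  exact: alg_pi_scalable.
pose f1 := GRing.isZmodMorphism.Build _ _ alg_quot_map fB.
pose f2 := GRing.isMonoidMorphism.Build _ _ alg_quot_map fM.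
pose f3 := GRing.isScalable.Build F _ _ *:%R alg_quot_map fZ.
pose f : {lrmorphism alg_quot I -> alg_quot J} :=
  HB.pack alg_quot_map f1 f2 f3.
by exists f.
Qed.

End AlgQuotientTheory.

(** Equal membership does not identify the quotient types; the maps induced by the two inclusions
    are mutually inverse. *)
Lemma alg_quot_iso (F : fieldType) (B : algType F) (I J : tsideal B) :
  (I : pred B) =i (J : pred B) -> alg_iso (alg_quot I) (alg_quot J).
Proof.
move=> eqIJ.
have IJ : {subset (I : pred B) <= (J : pred B)} by move=> x; rewrite eqIJ.
have JI : {subset (J : pred B) <= (I : pred B)} by move=> x; rewrite eqIJ.
have [f fE] := alg_quot_map_lrmorphism IJ.
exists f; exists (@alg_quot_map _ _ J I) => x; rewrite fE -[x]alg_reprK.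
  by rewrite (alg_quot_mapE IJ) (alg_quot_mapE JI).
by rewrite (alg_quot_mapE JI) (alg_quot_mapE IJ).
Qed.

Section TriOpTheory.
Variable F : fieldType.
Implicit Types (B C : algType F) (w : tri_op F).

(** The six coefficients of [w] are the same in every algebra, and [f] preserves each product. *)
Lemma tri_op_morph w B C (f : {lrmorphism B -> C}) (x y z : B) :
  f (w B x y z) = w C (f x) (f y) (f z).
Proof.
have [[[[[[c1 c2] c3] c4] c5] c6] wE] := tri_funP w.
by rewrite !wE !raddfD /= !linearZ /= !rmorphM.
Qed.

Lemma ord2_neq (i j k : 'I_2) : i != j -> k != i -> k = j.
Proof.
by case: i j k => [[|[|//]] ?] [[|[|//]] ?] [[|[|//]] ?] // _ _; apply/val_inj.
Qed.

(** Zero diagonals force consecutive indices to differ, so for distinct [i] and [j] the only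
    contributing index path is i, j, i, j; for i = j both sides vanish. *)
Lemma zero_diag_mul3E (x y z : 'M[F]_2) (i j : 'I_2) :
    zero_diag x -> zero_diag y -> zero_diag z ->
  (x * y * z) i j = x i j * y j i * z i j.
Proof.
move=> x0 y0 z0; have [<-|ij] := eqVneq i j.
  by rewrite !(zero_diagP _ _) ?mulr0 //; apply: zero_diag_mul3.
rewrite mxE (bigD1 i) //= [X in _ + X]big1 ?addr0 => [|k ki].
  rewrite mxE (bigD1 j) 1?eq_sym //= [X in _ + X]big1 ?addr0 // => k kj.
  have -> : k = i by apply: ord2_neq kj; rewrite eq_sym.
  by rewrite (zero_diagP _ x0) mul0r.
by rewrite (ord2_neq ij ki) (zero_diagP _ z0) mulr0.
Qed.

Lemma zero_diag_mul3C (x y z : 'M[F]_2) :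
  zero_diag x -> zero_diag y -> zero_diag z -> x * y * z = z * y * x.
Proof.
move=> x0 y0 z0; apply/matrixP => i j.
by rewrite !zero_diag_mul3E // [LHS]mulrC [LHS]mulrCA [LHS]mulrC.
Qed.

Lemma zd_op_anti_jordan (x y z : zdmat F) : zd_op (anti_jordan F) x y z = 0.
Proof.
apply/val_inj => /=; apply/eqP; rewrite subr_eq0; apply/eqP.
by apply: zero_diag_mul3C; exact: valP.
Qed.

(** The four terms xyz + xzy - yzx - zyx are regrouped by pairing each product with its reversal. *)
Lemma lie_family_anti_jordan B (x y z : B) :
  lie_family F B x y z
  = 2^-1 *: (anti_jordan F B x y z + anti_jordan F B x z y).
Proof.
rewrite /= /lie_bracket /jordan_prod -scalerAr -scalerAl -scalerBr.
by rewrite mulrDr mulrDl !mulrA addrACA opprD [- (y * z * x) - _]addrC.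
Qed.

Lemma zd_op_lie_family (x y z : zdmat F) : zd_op (lie_family F) x y z = 0.
Proof.
apply/val_inj; rewrite [LHS]lie_family_anti_jordan.
have vanish u v t := congr1 val (zd_op_anti_jordan u v t).
by move: (vanish x y z) (vanish x z y) => /= -> ->; rewrite addr0 scaler0.
Qed.

(** The envelope relations without their [phi] term, stated in any algebra so that they can be
    tested in a quotient. *)
Definition vanishes_on w B (a b : B) : Prop :=
  {in [:: a; b] & &, forall x y z, w B x y z = 0}.

Definition down_up010_rels (B : nzRingType) (a b : B) : Prop :=
  b ^+ 2 * a = a * b ^+ 2 /\ b * a ^+ 2 = a ^+ 2 * b.

(** As [zd_op w] is zero, each relation projects to [w] evaluated at the classes of the
    generators. *)
Lemma env_ideal_subP w (I : tsideal (free_alg F)) :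
    (forall x y z, zd_op w x y z = 0) ->
  {subset env_ideal w <= (I : pred (free_alg F))} <->
  vanishes_on w (alg_pi I (fa F)) (alg_pi I (fb F)).
Proof.
move=> w0; apply: (iff_trans (iff_sym (ideal_gen_subP I _))).
have relE x y z :
    alg_pi I (w (free_alg F) (phi x) (phi y) (phi z) - phi (zd_op w x y z))
    = w _ (alg_pi I (phi x)) (alg_pi I (phi y)) (alg_pi I (phi z)).
  by rewrite w0 linear0 subr0 tri_op_morph.
have gensE : [:: alg_pi I (fa F); alg_pi I (fb F)]
           = [seq alg_pi I (phi x) | x <- [:: e1 F; e2 F]].
  by rewrite /= phi_e1 phi_e2.
rewrite /vanishes_on gensE; split=> [rel0 | v0 _ [x y z xe ye ze]].
  move=> _ _ _ /mapP[x xe ->] /mapP[y ye ->] /mapP[z ze ->].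
  by rewrite -relE; apply: rel0.
by rewrite relE; apply: v0; apply: (map_f (fun x => alg_pi I (phi x))).
Qed.

Lemma down_up010_subP (I : tsideal (free_alg F)) :
  {subset down_up_ideal 0 1 0 <= (I : pred (free_alg F))} <->
  down_up010_rels (alg_pi I (fa F)) (alg_pi I (fb F)).
Proof.
apply: (iff_trans (iff_sym (ideal_gen_subP I _))).
have relE (u v t s : free_alg F) :
    alg_pi I (u - (0 *: v + 1 *: t + 0 *: s)) = alg_pi I u - alg_pi I t.
  by rewrite !scale0r scale1r add0r addr0 raddfB.
split=> [rel0 | [ba ab] _ []]; last 2 first.
- by rewrite relE !rmorphM /= ba subrr.
- by rewrite relE !rmorphM /= ab subrr.
have := rel0 _ (down_up_rel_ba 0 1 0); have := rel0 _ (down_up_rel_ab 0 1 0).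
by rewrite !relE !rmorphM => /subr0_eq ab /subr0_eq ba.
Qed.

(** Each inclusion is tested in the quotient by the larger ideal, where the relations generating
    that ideal hold and [wP] converts them. *)
Lemma env_ideal_down_up w :
    (forall x y z, zd_op w x y z = 0) ->
    (forall B (a b : B), vanishes_on w a b <-> down_up010_rels a b) ->
  env_ideal w =i down_up_ideal 0 1 0.
Proof.
move=> w0 wP x; apply/idP/idP; move: x.
  pose J : tsideal (free_alg F) := down_up_ideal 0 1 0.
  exact/(env_ideal_subP J w0)/wP/(down_up010_subP J).
pose I : tsideal (free_alg F) := env_ideal w.
exact/(down_up010_subP I)/wP/(env_ideal_subP I w0).
Qed.

(** Triples with equal outer entries give zero; the other four give the two relations, up to
    sign. *)
Lemma anti_jordan_vanishes_on B (a b : B) :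
  vanishes_on (anti_jordan F) a b <-> down_up010_rels a b.
Proof.
rewrite /down_up010_rels !expr2 !mulrA; split=> [v0 | [ba ab] x y z].
  have := v0 b b a; have := v0 a a b; rewrite !inE !eqxx !orbT /=.
  by move=> /(_ isT isT isT)/subr0_eq ab /(_ isT isT isT)/subr0_eq ba.
rewrite !inE => /orP[]/eqP-> /orP[]/eqP-> /orP[]/eqP-> /=;
  by rewrite ?subrr ?ba ?ab ?subrr.
Qed.

Lemma lie_family_vanishes_on B (a b : B) : 2 != 0 :> F ->
  vanishes_on (lie_family F) a b <-> vanishes_on (anti_jordan F) a b.
Proof.
move=> two_neq0; split=> v0.
  (* The relations of A(0,1,0) involve only triples (x, y, y), where symmetrizing in the last two
     arguments loses nothing. *)
  suff v1 x y : x \in [:: a; b] -> y \in [:: a; b] -> x * y * y = y * y * x.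
    apply/anti_jordan_vanishes_on; rewrite /down_up010_rels !expr2.
    by split; rewrite mulrA v1 ?inE ?eqxx ?orbT.
  (* Both anti-Jordan terms now agree, leaving [2^-1] times twice one element; [two_neq0] cancels
     both scalars. *)
  move=> xe ye; apply: subr0_eq; move: (v0 x y y xe ye ye).
  rewrite lie_family_anti_jordan => /eqP; rewrite scaler_eq0 invr_eq0.
  rewrite (negPf two_neq0) /= -mulr2n -scaler_nat scaler_eq0.
  by rewrite (negPf two_neq0) => /eqP.
move=> x y z xe ye ze.
by rewrite lie_family_anti_jordan !v0 // addr0 scaler0.
Qed.

End TriOpTheory.

Theorem proposition4p27 (F : fieldType) (charF0 : [pchar F] =i pred0) :
  alg_iso (univ_env (anti_jordan F)) (down_up 0 1 0) /\
  alg_iso (univ_env (anti_jordan F)) (univ_env (lie_family F)).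
Proof.
(* Characteristic zero enters through the cancellation of 2 in the Lie family. *)
have two_neq0 : 2 != 0 :> F by rewrite ((pcharf0P F).1 charF0).
have jordanE := env_ideal_down_up (@zd_op_anti_jordan F)
  (@anti_jordan_vanishes_on F).
have lieE := env_ideal_down_up (@zd_op_lie_family F)
  (fun B a b => iff_trans (lie_family_vanishes_on a b two_neq0)
                          (anti_jordan_vanishes_on a b)).
split; apply: alg_quot_iso => x; first exact: jordanE.
by rewrite jordanE lieE.
Qed.
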